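(* For every integer $k\ge 2$ there exists a quantum triorthogonal code with parameters $$\Big[\!\Big[\tfrac{4k^4+8k^3+2k^2-8k-3}{3},\;1,\;2k-1\Big]\!\Big]$$ and with the local geometry of the rotated surface code of distance $2k-1$.
   Context: CSS codes: for binary linear codes $C_2\subseteq C_1\subseteq\mathbb{F}_2^n$ with $\dim C_1-\dim C_2=k'$, the CSS code of $C_2\subseteq C_1$ is the $n$-qubit stabilizer code whose $X$-stabilizers are the $X^{c}$, $c\in C_2$, and whose $Z$-stabilizers are the $Z^{c}$, $c\in C_1^\perp$ (Euclidean dual). Its parameters are $[\![n,k',d]\!]$ with $d=\min\{d_x,d_z\}$, where $d_x$ is the minimum Hamming weight of $C_1\setminus C_2$ and $d_z$ that of $C_2^\perp\setminus C_1^\perp$. Logical $X$- and $Z$-operators are the elements of $C_1\setminus C_2$ and $C_2^\perp\setminus C_1^\perp$. Triorthogonal codes: a binary $m\times n$ matrix $G$ is triorthogonal if $\sum_j G_{aj}G_{bj}\equiv 0\pmod 2$ for all pairs of rows $a<b$ and $\sum_j G_{aj}G_{bj}G_{cj}\equiv0\pmod 2$ for all triples of rows $a<b<c$. A triorthogonal code encoding $k'$ logical qubits is the CSS code of $C_2\subseteq C_1$ where $C_1$ is generated by the rows of a triorthogonal matrix $G$ consisting of $k'$ odd-weight rows (forming $G_1$) together with even-weight rows (forming $G_0$), and $C_2$ is generated by the rows of $G_0$. Local geometry: a CSS code $Q$ (of $C_2\subseteq C_1$) has a local geometry of a CSS code $Q'$ (of $C_2'\subseteq C_1'$) if there is a subset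 $A$ of the data qubits of $Q$ (identified with the data qubits of $Q'$) such that (puncturing rule) $C_2|_A=C_2'$ and $C_1|_A=C_1'$; and (shortening rule) $\{z\in C_1^\perp:\mathrm{supp}\,z\subseteq A\}$ and $\{z\in C_2^\perp:\mathrm{supp}\,z\subseteq A\}$, restricted to $A$, are $C_1'^\perp$ and $C_2'^\perp$. Rotated surface code of odd distance $d\ge 3$: the $[\![d^2,1,d]\!]$ CSS code with qubits at the points $(x,y)$, $0\le x,y\le d-1$. For integers $a,b$ let $P_{a,b}=\{a,a+1\}\times\{b,b+1\}$ intersected with the grid. The $X$-stabilizer generators are supported on $P_{a,b}$ with $a+b$ odd, $0\le a\le d-2$, $-1\le b\le d-1$; the $Z$-stabilizer generators are supported on $P_{a,b}$ with $a+b$ even, $-1\le a\le d-1$, $0\le b\le d-2$. The all-ones vector is a logical $X$-operator. *)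

(* Defs.v *)
From HB Require Import structures.
From mathcomp Require Import all_boot all_order all_algebra.
From mathcomp Require Import zify.

Set Implicit Arguments.
Unset Strict Implicit.
Unset Printing Implicit Defensive.

Import Order.TTheory GRing.Theory Num.Theory.
Local Open Scope ring_scope.

Notation code n := {vspace 'rV['F_2]_n}.

Definition supp n (v : 'rV['F_2]_n) : {set 'I_n} := [set j | v 0 j != 0].

Definition wt n (v : 'rV['F_2]_n) : nat := #|supp v|.

(* The Euclidean dual; see [mem_dualP]. *)
Definition dual n (C : code n) : code n :=
  (\bigcap_(c in C) lker (linfun (mulmxr c^T)))%VS.

Lemma mem_dualP n (C : code n) (u : 'rV['F_2]_n) :
  reflect (forall c, c \in C -> \sum_j u 0 j * c 0 j = 0) (u \in dual C).
Proof.
have dotE (c : 'rV['F_2]_n) :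
    (u \in lker (linfun (mulmxr c^T))) = (\sum_j u 0 j * c 0 j == 0).
  rewrite memv_ker lfunE /=; apply/eqP/eqP => [/matrixP/(_ 0 0)|uc0].
    rewrite !mxE; apply: etrans.
    by apply: eq_bigr => j _; rewrite mxE.
  apply/matrixP => i j; rewrite !ord1 !mxE; apply: etrans uc0.
  by apply: eq_bigr => l _; rewrite mxE.
rewrite memvE; apply: (iffP subv_bigcapP) => uC c Cc.
  by apply/eqP; rewrite -dotE memvE; exact: uC.
by rewrite -memvE dotE; apply/eqP/uC.
Qed.

Definition rowspan m n (G : 'M['F_2]_(m, n)) : code n :=
  <<[seq row i G | i <- enum 'I_m]>>%VS.

(* The CSS code of C2 <= C1 is represented by this pair: C2 and the dual of C1
   are the supports of its X- and Z-stabilizers respectively. *)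
Record css_code (n : nat) := CSSCode {
  css_C1 : code n;
  css_C2 : code n;
  css_sub : (css_C2 <= css_C1)%VS
}.

Definition is_min_wt n (S : pred 'rV['F_2]_n) (w : nat) : Prop :=
  (exists2 v, S v & wt v = w) /\ (forall v, S v -> (w <= wt v)%N).

Definition logicalX n (Q : css_code n) : pred 'rV['F_2]_n :=
  fun v => (v \in css_C1 Q) && (v \notin css_C2 Q).

Definition logicalZ n (Q : css_code n) : pred 'rV['F_2]_n :=
  fun v => (v \in dual (css_C2 Q)) && (v \notin dual (css_C1 Q)).

(* [Q] has parameters [[n, k, d]]; the length [n] is carried by its type.
   The subtraction is not truncated, by [css_sub]. *)
Definition css_parameters n (Q : css_code n) (k d : nat) : Prop :=
  (\dim (css_C1 Q) - \dim (css_C2 Q))%N = k /\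
  exists dx dz : nat,
    [/\ is_min_wt (logicalX Q) dx, is_min_wt (logicalZ Q) dz & d = minn dx dz].

Definition triorthogonal m n (G : 'M['F_2]_(m, n)) : Prop :=
  (forall a b : 'I_m, (a < b)%N -> \sum_j G a j * G b j = 0) /\
  (forall a b c : 'I_m, (a < b)%N -> (b < c)%N ->
     \sum_j G a j * G b j * G c j = 0).

(* The condition on G does not depend on the order of its rows, so the odd rows
   G1 are placed above the even rows G0. *)
Definition triorthogonal_code n (k : nat) (Q : css_code n) : Prop :=
  exists (m0 : nat) (G1 : 'M['F_2]_(k, n)) (G0 : 'M['F_2]_(m0, n)),
    [/\ triorthogonal (col_mx G1 G0),
        forall i, odd (wt (row i G1)),
        forall i, ~~ odd (wt (row i G0)),
        css_C1 Q = rowspan (col_mx G1 G0)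
      & css_C2 Q = rowspan G0].

Section LocalGeometry.
Variables (n n' : nat) (f : 'I_n' -> 'I_n).

(* An injective [f] identifies the qubits 'I_n' with the subset A = codom f of
   'I_n, and [colsub f] is the restriction of vectors to A. *)
Definition punctured (C : code n) : {set 'rV['F_2]_n'} :=
  [set colsub f c | c in C].

Definition shortened (C : code n) : {set 'rV['F_2]_n'} :=
  [set colsub f z | z in C & supp z \subset codom f].

End LocalGeometry.

Definition has_local_geometry n n' (Q : css_code n) (Q' : css_code n') : Prop :=
  exists f : 'I_n' -> 'I_n,
    [/\ injective f,
        punctured f (css_C2 Q) = [set c in css_C2 Q'],
        punctured f (css_C1 Q) = [set c in css_C1 Q'],
        shortened f (dual (css_C1 Q)) = [set z in dual (css_C1 Q')]
      & shortened f (dual (css_C2 Q)) = [set z in dual (css_C2 Q')]].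

Definition in_plaquette (a b x y : int) : bool :=
  (x \in [:: a; a + 1]) && (y \in [:: b; b + 1]).

(* The indicator vector of the part of P_{a,b} in the d x d grid; the qubit
   (x, y) has index [mxvec_index x y]. *)
Definition plaquette (d : nat) (a b : int) : 'rV['F_2]_(d * d) :=
  mxvec (\matrix_(x < d, y < d) (in_plaquette a b x%:Z y%:Z)%:R).

(* 0 <= a <= d - 2, -1 <= b <= d - 1 and a + b odd. *)
Definition surface_X_generators (d : nat) : seq 'rV['F_2]_(d * d) :=
  [seq plaquette d p.1 p.2
     | p : int * int <-
         [seq (i%:Z, j%:Z - 1 : int) | i <- iota 0 d.-1, j <- iota 0 d.+1]
     & odd `|(p.1 + p.2)%R|%N].

(* -1 <= a <= d - 1, 0 <= b <= d - 2 and a + b even. *)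
Definition surface_Z_generators (d : nat) : seq 'rV['F_2]_(d * d) :=
  [seq plaquette d p.1 p.2
     | p : int * int <-
         [seq (i%:Z - 1 : int, j%:Z) | i <- iota 0 d.+1, j <- iota 0 d.-1]
     & ~~ odd `|(p.1 + p.2)%R|%N].

Definition surface_C2 (d : nat) : code (d * d) :=
  <<surface_X_generators d>>%VS.

Definition surface_C1 (d : nat) : code (d * d) :=
  dual <<surface_Z_generators d>>%VS.

Definition segment (d : nat) (a : int) : 'rV['F_2]_d :=
  \row_x (x%:Z \in [:: a; a + 1])%:R.

Lemma plaquetteE d a b :
  plaquette d a b = mxvec ((segment d a)^T *m segment d b).
Proof.
congr mxvec; apply/matrixP => x y.
by rewrite !mxE big_ord1 !mxE /in_plaquette -natrM mulnb.
Qed.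

Lemma segment_overlap d (i : nat) (a : int) : (i.+1 < d)%N ->
  segment d i%:Z *m (segment d a)^T != 0 -> odd `|(i%:Z + a)%R|%N.
Proof.
move=> lti; have lti' : (i < d)%N by exact: ltnW.
have ->: segment d i%:Z = delta_mx 0 (Ordinal lti') + delta_mx 0 (Ordinal lti).
  apply/rowP => x; rewrite !mxE !inE eqxx -!val_eqE /=.
  have [->|xi] := eqVneq (x : nat) i; first by rewrite eqxx ltn_eqF ?addr0.
  by rewrite -PoszD addn1 !eqz_nat (negPf xi) add0r.
rewrite mulmxDl -!rowE; apply: contraR => ev; apply/eqP/matrixP => u v.
rewrite !ord1 !mxE !inE /=.
have [ia|ia] := eqVneq i%:Z a.
  have -> : (i.+1%:Z == a) || (i.+1%:Z == a + 1) by lia.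
  by apply/val_inj.
have -> : (i%:Z == a + 1) = false by lia.
have -> : (i.+1%:Z == a) || (i.+1%:Z == a + 1) = false by lia.
by rewrite addr0.
Qed.

Lemma plaquette_orthogonal d (i j : nat) (a b : int) :
    (i.+1 < d)%N -> (j.+1 < d)%N -> odd `|(i%:Z + b)%R|%N ->
    ~~ odd `|(a + j%:Z)%R|%N ->
  plaquette d i%:Z b *m (plaquette d a j%:Z)^T = 0.
Proof.
move=> lti ltj oddX evenZ; rewrite !plaquetteE mxvec_dotmul.
have -> : segment d i%:Z *m ((segment d a)^T *m segment d j%:Z) *m
      (segment d b)^T
    = (segment d i%:Z *m (segment d a)^T) *m
      (segment d j%:Z *m (segment d b)^T) by rewrite !mulmxA.
have [->|/(segment_overlap lti) oi] :=
    eqVneq (segment d i%:Z *m (segment d a)^T) 0.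
  by rewrite mul0mx.
have [->|/(segment_overlap ltj) oj] :=
    eqVneq (segment d j%:Z *m (segment d b)^T) 0.
  by rewrite mulmx0.
by exfalso; lia.
Qed.

Lemma surface_sub d : (surface_C2 d <= surface_C1 d)%VS.
Proof.
apply/span_subvP => _ /mapP[p + ->]; rewrite mem_filter => /andP[oddX].
case/allpairsP => -[i j] /=; rewrite !mem_iota => -[ltid ltjd pE].
rewrite {}pE /= in oddX *; rewrite memvE; apply/subv_bigcapP => c Cc.
rewrite -memvE memv_ker lfunE /=; apply/eqP.
suff /subvP/(_ c Cc) : (<<surface_Z_generators d>> <=
    lker (linfun (mulmxr (plaquette d i%:Z (j%:Z - 1))^T)))%VS.
  rewrite memv_ker lfunE /= => /eqP/(congr1 trmx).
  by rewrite trmx_mul trmxK trmx0.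
apply/span_subvP => _ /mapP[q + ->]; rewrite mem_filter => /andP[evenZ].
case/allpairsP => -[i' j'] /=; rewrite !mem_iota => -[ltid' ltjd' qE].
rewrite {}qE /= in evenZ *; rewrite memv_ker lfunE /=; apply/eqP/trmx_inj.
rewrite trmx_mul trmxK trmx0; apply: plaquette_orthogonal => //; lia.
Qed.

Definition rotated_surface_code (d : nat) : css_code (d * d) :=
  CSSCode (surface_sub d).

(* Main.v *)
Require Import Defs.
From mathcomp Require Import all_boot all_order all_algebra.
From mathcomp Require Import zify ring lra.
Import Order.TTheory GRing.Theory Num.Theory.
Local Open Scope ring_scope.

(** All codes involved have the form C1 = C2 + <1> with n odd, so they are
    determined by C = C2, and d_z is the least odd weight in the dual of C.
    The doubling of A (length n1) and B (length n2) is the space of all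
    (a, a + c1, b + c1) of length 2 n1 + n2. It restricts to A on the first
    block, and its d_z is at least min (d_z A, d_z B + 2): if (x, y, z) in its
    dual has odd weight, then either x + y is an odd vector of the dual of A, or
    x, y and z are all odd and z is in the dual of B. Doubling raises the level of
    orthogonality: A even and B self-orthogonal give a self-orthogonal code,
    A self-orthogonal and B triorthogonal give a triorthogonal one. Hence
    E_k = double S_k E_(k-1), with S_k the surface code of distance 2k - 1, is
    self-orthogonal of length (8 k^3 - 2 k - 3) / 3, and
    T_k = double E_k T_(k-1) is the required triorthogonal code. *)

Set Implicit Arguments.
Unset Strict Implicit.
Unset Printing Implicit Defensive.

(** * Inner products and weights over the two-element field *)

Lemma F2P (x : 'F_2) : x = 0 \/ x = 1.
Proof. by case: x => [[|[|m]] lt_m] //; [left | right]; apply: val_inj. Qed.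

Lemma addxx_F2 (x : 'F_2) : x + x = 0.
Proof. by case: (F2P x) => ->; apply: val_inj. Qed.

Lemma addr_eq0_F2 (x y : 'F_2) : x + y = 0 -> x = y.
Proof. by case: (F2P x) => ->; case: (F2P y) => -> // /eqP. Qed.

Lemma neq0_F2 (x : 'F_2) : x = (x != 0)%:R.
Proof. by case: (F2P x) => ->. Qed.

Lemma natr_F2 (m : nat) : m%:R = (odd m)%:R :> 'F_2.
Proof.
by rewrite -[in LHS](odd_double_half m) natrD -addnn natrD addxx_F2 addr0.
Qed.

Definition dot n (u v : 'rV['F_2]_n) : 'F_2 := \sum_j u 0 j * v 0 j.

Definition ones n : 'rV['F_2]_n := const_mx 1.

Lemma dotC n (u v : 'rV['F_2]_n) : dot u v = dot v u.
Proof. by apply: eq_bigr => j _; rewrite mulrC. Qed.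

Lemma dotDl n (u v w : 'rV['F_2]_n) : dot (u + v) w = dot u w + dot v w.
Proof. by rewrite -big_split; apply: eq_bigr => j _; rewrite mxE mulrDl. Qed.

Lemma dotZl n c (u w : 'rV['F_2]_n) : dot (c *: u) w = c * dot u w.
Proof. by rewrite mulr_sumr; apply: eq_bigr => j _; rewrite mxE mulrA. Qed.

Lemma dotDr n (u v w : 'rV['F_2]_n) : dot w (u + v) = dot w u + dot w v.
Proof. by rewrite dotC dotDl !(dotC w). Qed.

Lemma dotZr n c (u w : 'rV['F_2]_n) : dot w (c *: u) = c * dot w u.
Proof. by rewrite dotC dotZl dotC. Qed.

Lemma dot0l n (u : 'rV['F_2]_n) : dot 0 u = 0.
Proof. by apply: big1 => j _; rewrite mxE mul0r. Qed.

Lemma dot_row_mx n1 n2 (u u' : 'rV['F_2]_n1) (v v' : 'rV['F_2]_n2) :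
  dot (row_mx u v) (row_mx u' v') = dot u u' + dot v v'.
Proof.
rewrite /dot big_split_ord; congr (_ + _); apply: eq_bigr => j _.
  by rewrite !row_mxEl.
by rewrite !row_mxEr.
Qed.

Lemma dot_ones n (u : 'rV['F_2]_n) : dot u (ones n) = \sum_j u 0 j.
Proof. by apply: eq_bigr => j _; rewrite mxE mulr1. Qed.

Lemma dot_mx n (u v : 'rV['F_2]_n) : u *m v^T = (dot u v)%:M.
Proof.
apply/rowP => i; rewrite !ord1 !mxE mulr1n.
by apply: eq_bigr => j _; rewrite mxE.
Qed.

Lemma wtE n (u : 'rV['F_2]_n) : wt u = (\sum_j (u 0 j != 0)%R)%N.
Proof.
rewrite /wt -sum1_card [RHS]big_mkcond [LHS]big_mkcond.
by apply: eq_bigr => j _; rewrite inE; case: ifP.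
Qed.

Lemma wt_row_mx n1 n2 (u : 'rV['F_2]_n1) (v : 'rV['F_2]_n2) :
  wt (row_mx u v) = (wt u + wt v)%N.
Proof.
rewrite !wtE big_split_ord; congr (_ + _)%N; apply: eq_bigr => j _.
  by rewrite row_mxEl.
by rewrite row_mxEr.
Qed.

Lemma wt0 n : wt (0 : 'rV['F_2]_n) = 0%N.
Proof. by rewrite wtE big1 // => j _; rewrite mxE eqxx. Qed.

Lemma wtD n (u v : 'rV['F_2]_n) : (wt (u + v) <= wt u + wt v)%N.
Proof.
rewrite !wtE -big_split leq_sum //= => j _; rewrite mxE.
by case: (F2P (u 0 j)) => ->; case: (F2P (v 0 j)) => ->.
Qed.

Lemma dot_ones_odd n (u : 'rV['F_2]_n) : dot u (ones n) = (odd (wt u))%:R.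
Proof.
rewrite dot_ones -natr_F2 wtE natr_sum.
by apply: eq_bigr => j _; rewrite -neq0_F2.
Qed.

Lemma odd_wt n (u : 'rV['F_2]_n) : odd (wt u) = (dot u (ones n) != 0).
Proof. by rewrite dot_ones_odd; case: odd. Qed.

Lemma wt_ones n : wt (ones n) = n.
Proof.
rewrite wtE (eq_bigr (fun=> 1%N)) ?sum1_card ?card_ord // => j _.
by rewrite mxE.
Qed.

(** * Duals and the all-ones vector *)

Definition perp n (u : 'rV['F_2]_n) : code n := lker (linfun (mulmxr u^T)).

Lemma mem_perp n (u c : 'rV['F_2]_n) : (c \in perp u) = (dot u c == 0).
Proof.
rewrite memv_ker lfunE /= dot_mx dotC; apply/eqP/eqP => [/matrixP/(_ 0 0)|->].
  by rewrite !mxE.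
exact: raddf0.
Qed.

(** Fixing u and letting C vary turns duality into an inclusion of subspaces, which can be tested on
    generators of C and on the summands of a sum. *)
Lemma mem_dual n (C : code n) (u : 'rV['F_2]_n) :
  (u \in dual C) = (C <= perp u)%VS.
Proof.
apply/mem_dualP/subvP => uC c Cc; first by rewrite mem_perp; apply/eqP/uC.
by apply/eqP; rewrite -/(dot u c) -mem_perp uC.
Qed.

Lemma dual_orth n (C : code n) (u c : 'rV['F_2]_n) :
  u \in dual C -> c \in C -> dot u c = 0.
Proof. by move/mem_dualP; apply. Qed.

Lemma mem_dual_span n (X : seq 'rV['F_2]_n) (u : 'rV['F_2]_n) :
  reflect {in X, forall c, dot u c = 0} (u \in dual <<X>>%VS).
Proof.
rewrite mem_dual; apply: (iffP span_subvP) => uX c /uX.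
  by rewrite mem_perp => /eqP.
by move/eqP; rewrite -mem_perp.
Qed.

Definition add_ones n (C : code n) : code n := (C + <[ones n]>)%VS.

Lemma sub_add_ones n (C : code n) : (C <= add_ones C)%VS.
Proof. exact: addvSl. Qed.

Lemma mem_add_onesP n (C : code n) (v : 'rV['F_2]_n) :
  reflect (exists2 c, c \in C & exists x, v = c + x *: ones n)
          (v \in add_ones C).
Proof.
apply: (iffP memv_addP) => [[c Cc [_ /vlineP[x ->] ->]]|[c Cc [x ->]]].
  by exists c => //; exists x.
by exists c => //; exists (x *: ones n) => //; rewrite memvZ ?memv_line.
Qed.

(** Consequently the logical Z-operators of the pair C, [add_ones C] are exactly the odd vectors of
    the dual of C. *)
Lemma mem_dual_add_ones n (C : code n) (u : 'rV['F_2]_n) :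
  (u \in dual (add_ones C)) = (u \in dual C) && ~~ odd (wt u).
Proof. by rewrite !mem_dual subv_add -memvE mem_perp odd_wt negbK. Qed.

(** * Puncturing and shortening *)

Lemma puncturedP n n' (f : 'I_n' -> 'I_n) (C : code n) (C' : code n') :
  punctured f C = [set c in C'] <->
  {in C, forall c, colsub f c \in C'} /\
  {in C', forall c', exists2 c, c \in C & c' = colsub f c}.
Proof.
split=> [/setP CC'|[fC fC']].
  split=> [c Cc|c' C'c'].
    by have := CC' (colsub f c); rewrite inE imset_f.
  by have := CC' c'; rewrite inE C'c' => /imsetP.
apply/setP => v; rewrite inE; apply/imsetP/idP => [[c Cc ->]|]; first exact: fC.
exact: fC'.
Qed.

Lemma punctured_comp n n' n'' (g : 'I_n' -> 'I_n) (f : 'I_n'' -> 'I_n')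
    (C : code n) (C' : code n') (C'' : code n'') :
  punctured g C = [set c in C'] -> punctured f C' = [set c in C''] ->
  punctured (g \o f) C = [set c in C''].
Proof.
have colE (c : 'rV['F_2]_n) : colsub (g \o f) c = colsub f (colsub g c).
  by apply/rowP => i; rewrite !mxE.
move=> /puncturedP[gC gC'] /puncturedP[fC' fC'']; apply/puncturedP.
split=> [c Cc|v /fC''[_ /gC'[c Cc ->] ->]]; first by rewrite colE; apply/fC'/gC.
by exists c.
Qed.

Section Geometry.
Variables (n n' : nat) (f : 'I_n' -> 'I_n).

Lemma punctured_add_ones (C : code n) (C' : code n') :
  punctured f C = [set c in C'] ->
  punctured f (add_ones C) = [set c in add_ones C'].
Proof.
have f_ones : colsub f (ones n) = ones n' by apply/rowP => i; rewrite !mxE.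
move=> /puncturedP[fC fC']; apply/puncturedP; split=> v.
  case/mem_add_onesP=> c Cc [x ->]; apply/mem_add_onesP.
  exists (colsub f c); first exact: fC.
  by exists x; rewrite linearD linearZ /= f_ones.
case/mem_add_onesP=> _ /fC'[c Cc ->] [x ->]; exists (c + x *: ones n).
  by apply/mem_add_onesP; exists c => //; exists x.
by rewrite linearD linearZ /= f_ones.
Qed.

Hypothesis f_inj : injective f.

Lemma dot_colsub (w c : 'rV['F_2]_n) : supp w \subset codom f ->
  dot w c = dot (colsub f w) (colsub f c).
Proof.
move=> /subsetP sub_w; rewrite /dot (bigID (mem (codom f))) /=.
rewrite [X in _ + X]big1 ?addr0 => [|j]; last first.
  apply: contraNeq => wc; apply: sub_w; rewrite inE.
  by apply: contraNneq wc => ->; rewrite mul0r.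
rewrite (eq_bigl (mem (f @: setT))) => [|j]; last first.
  by apply/codomP/imsetP => [[i ->]|[i _ ->]]; exists i.
rewrite big_imset => [|i i' _ _ /f_inj //].
by apply: eq_big => [i|i _]; rewrite ?inE ?mxE.
Qed.

(** A vector supported on the image of f pairs with c only through the restriction of c, so
    shortening the dual is dual to puncturing. Both shortening rules thus follow from the puncturing
    rules. *)
Lemma shortened_dual (C : code n) (C' : code n') :
  punctured f C = [set c in C'] ->
  shortened f (dual C) = [set z in dual C'].
Proof.
move=> /puncturedP[fC fC']; apply/setP => z; rewrite inE.
apply/imsetP/idP => [[w /[!inE]/andP[dCw sub_w] ->]|dCz].
  apply/mem_dualP => _ /fC'[c Cc ->].
  by rewrite -[LHS]dot_colsub //; apply: dual_orth dCw Cc.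
(* Extension of z by zero: as f is injective, each sum has at most one term. *)
pose w : 'rV['F_2]_n := \row_j \sum_(i | f i == j) z 0 i.
have wz : colsub f w = z.
  apply/rowP => i; rewrite !mxE (big_pred1 i) // => i' /=.
  by rewrite (inj_eq f_inj).
have sub_w : supp w \subset codom f.
  apply/subsetP => j; rewrite inE mxE; apply: contraR => /codomP j_f.
  by apply/eqP/big1 => i /eqP fi; case: j_f; exists i.
exists w => //; rewrite inE sub_w andbT; apply/mem_dualP => c Cc.
by rewrite -[LHS]/(dot w c) dot_colsub // wz; apply: dual_orth dCz (fC _ Cc).
Qed.

End Geometry.

(** * The doubling construction *)

Section Doubling.
Variables (n1 n2 : nat) (A : code n1) (B : code n2).

Definition double : code (n1 + (n1 + n2)) :=
  (linfun (mulmxr (row_mx 1%:M (row_mx 1%:M 0))) @: A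
   + linfun (mulmxr (row_mx 0 (row_mx 0 1%:M))) @: B
   + <[row_mx 0 (ones (n1 + n2))]>)%VS.

Lemma mem_doubleP (v : 'rV['F_2]_(n1 + (n1 + n2))) :
  reflect (exists a b c, [/\ a \in A, b \in B &
            v = row_mx a (row_mx (a + c *: ones n1) (b + c *: ones n2))])
          (v \in double).
Proof.
have vE (a : 'rV_n1) (b : 'rV_n2) c :
    row_mx a (row_mx (a + c *: ones n1) (b + c *: ones n2)) =
    a *m row_mx 1%:M (row_mx 1%:M 0) + b *m row_mx 0 (row_mx 0 1%:M)
    + c *: row_mx 0 (ones (n1 + n2)).
  rewrite /ones -(@row_mx_const _ 1 n1 n2) !mul_mx_row !mulmx1 !mulmx0 !scale_row_mx.
  by rewrite scaler0 !add_row_mx !addr0 add0r.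
apply: (iffP memv_addP) => [[w /memv_addP abw [_ /vlineP[c ->] ->]]|].
  case: abw => _ /memv_imgP[a Aa ->] [_ /memv_imgP[b Bb ->] ->].
  by exists a, b, c; split => //; rewrite vE !lfunE.
case=> a [b [c [Aa Bb ->]]]; rewrite vE.
exists (a *m row_mx 1%:M (row_mx 1%:M 0) + b *m row_mx 0 (row_mx 0 1%:M)).
  apply: memv_add; apply/memv_imgP; first by exists a; rewrite ?lfunE.
  by exists b; rewrite ?lfunE.
by exists (c *: row_mx 0 (ones (n1 + n2))); rewrite ?memvZ ?memv_line.
Qed.

(** The pairing with (a, a + c1, b + c1) is (x + y).a + z.b + c(|y| + |z|). Since a, b and c vary
    independently, the three terms vanish separately. *)
Lemma mem_dual_double (x y : 'rV['F_2]_n1) (z : 'rV['F_2]_n2) :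
  reflect [/\ x + y \in dual A, z \in dual B & odd (wt y) = odd (wt z)]
          (row_mx x (row_mx y z) \in dual double).
Proof.
have dotE a b c :
    dot (row_mx x (row_mx y z))
        (row_mx a (row_mx (a + c *: ones n1) (b + c *: ones n2))) =
    dot (x + y) a + dot z b + c * (odd (wt y) (+) odd (wt z))%:R.
  rewrite !dot_row_mx !dotDr dotDl !dotZr !dot_ones_odd.
  have -> : (odd (wt y) (+) odd (wt z))%:R =
      (odd (wt y))%:R + (odd (wt z))%:R :> 'F_2.
    by rewrite -natrD [RHS]natr_F2 oddD !oddb.
  by ring.
apply: (iffP (mem_dualP _ _)) => [dD|[dA dB yz] v].
  have {}dD a b c : a \in A -> b \in B ->
      dot (x + y) a + dot z b + c * (odd (wt y) (+) odd (wt z))%:R = 0.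
    by move=> Aa Bb; rewrite -dotE; apply: dD; apply/mem_doubleP; exists a, b, c.
  split; last by move: (dD 0 0 1 (mem0v _) (mem0v _));
    rewrite !(dotC _ 0) !dot0l !add0r mul1r; do 2!case: odd.
  - apply/mem_dualP => a Aa; move: (dD a 0 0 Aa (mem0v _)).
    by rewrite (dotC z) dot0l mul0r !addr0.
  - apply/mem_dualP => b Bb; move: (dD 0 b 0 (mem0v _) Bb).
    by rewrite (dotC (x + y)) dot0l mul0r add0r addr0.
case/mem_doubleP => a [b [c [Aa Bb ->]]].
rewrite -[LHS]/(dot _ _) dotE yz addbb mulr0 (dual_orth dA Aa) (dual_orth dB Bb).
by rewrite !addr0.
Qed.

Lemma punctured_double :
  punctured (@lshift n1 (n1 + n2)) double = [set c in A].
Proof.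
have colE (u : 'rV['F_2]_n1) (v : 'rV['F_2]_(n1 + n2)) :
    colsub (@lshift n1 (n1 + n2)) (row_mx u v) = u.
  by apply/rowP => i; rewrite mxE row_mxEl.
apply/puncturedP; split=> [v|v Av].
  by case/mem_doubleP => a [b [c [Aa Bb ->]]]; rewrite colE.
exists (row_mx v (row_mx (v + 0 *: ones n1) (0 + 0 *: ones n2))); last first.
  by rewrite colE.
by apply/mem_doubleP; exists v, 0, 0; rewrite mem0v.
Qed.

End Doubling.

(** * Odd dual weights and levels of orthogonality *)

Definition min_dual_wt n (C : code n) (d : nat) : Prop :=
  forall z, z \in dual C -> odd (wt z) -> (d <= wt z)%N.

Definition attains_dual_wt n (C : code n) (d : nat) : Prop :=
  exists z, [/\ z \in dual C, odd (wt z) & wt z = d].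

Definition self_orthogonal n (C : code n) : Prop :=
  {in C &, forall u v, dot u v = 0}.

Definition even_code n (C : code n) : Prop :=
  {in C, forall u, dot u (ones n) = 0}.

Definition triple n (u v w : 'rV['F_2]_n) : 'F_2 :=
  \sum_j u 0 j * v 0 j * w 0 j.

(** Repeated arguments are allowed, unlike in [triorthogonal]. Since squaring is the identity on the
    field, the condition therefore contains self-orthogonality, and with it evenness. *)
Definition triorthogonal_space n (C : code n) : Prop :=
  forall u v w, u \in C -> v \in C -> w \in C -> triple u v w = 0.

Lemma triple_dup n (u v : 'rV['F_2]_n) : triple u v v = dot u v.
Proof.
by apply: eq_bigr => j _; case: (F2P (v 0 j)) => ->; rewrite !(mulr0, mulr1).
Qed.

Lemma dot_dup n (u : 'rV['F_2]_n) : dot u u = dot u (ones n).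
Proof.
by apply: eq_bigr => j _; rewrite mxE; case: (F2P (u 0 j)) => ->;
  rewrite !(mulr0, mulr1).
Qed.

Lemma triorthogonal_self_orthogonal n (C : code n) :
  triorthogonal_space C -> self_orthogonal C.
Proof. by move=> triC u v Cu Cv; rewrite -triple_dup; apply: triC. Qed.

Lemma self_orthogonal_even n (C : code n) : self_orthogonal C -> even_code C.
Proof. by move=> orthC u Cu; rewrite -dot_dup; apply: orthC. Qed.

Lemma dot_ones_ones_odd n : odd n -> dot (ones n) (ones n) = 1.
Proof. by rewrite dot_ones_odd wt_ones => ->. Qed.

Lemma tripleD_ones n (u v w : 'rV['F_2]_n) c c' c'' :
  triple (u + c *: ones n) (v + c' *: ones n) (w + c'' *: ones n) =
  triple u v w + c * dot v w + c' * dot u w + c'' * dot u v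
  + c * c' * dot w (ones n) + c * c'' * dot v (ones n)
  + c' * c'' * dot u (ones n) + c * c' * c'' * dot (ones n) (ones n).
Proof.
rewrite /triple /dot !mulr_sumr -!big_split; apply: eq_bigr => j _.
by rewrite !mxE /=; ring.
Qed.

Lemma triple_row_mx m1 m2 (u v w : 'rV['F_2]_m1) (u' v' w' : 'rV['F_2]_m2) :
  triple (row_mx u u') (row_mx v v') (row_mx w w') =
  triple u v w + triple u' v' w'.
Proof.
rewrite /triple big_split_ord; congr (_ + _); apply: eq_bigr => j _.
  by rewrite !row_mxEl.
by rewrite !row_mxEr.
Qed.

Section DoublingProperties.
Variables (n1 n2 : nat) (A : code n1) (B : code n2).
Lemma min_dual_wt_double dA dB :
    min_dual_wt A dA -> min_dual_wt B dB ->
  min_dual_wt (double A B) (minn dA (dB + 2)).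
Proof.
move=> minA minB v.
rewrite -[v]hsubmxK; set x := lsubmx v.
rewrite -[rsubmx v]hsubmxK; set y := lsubmx _; set z := rsubmx _.
move=> /mem_dual_double[dA_xy dB_z yz].
(* The parities of y and z cancel, so x carries the odd parity of the whole vector. *)
rewrite !wt_row_mx !oddD yz addbb addbF => odd_x.
have odd_xy : odd (wt (x + y)) = odd (wt x) (+) odd (wt y).
  rewrite !odd_wt dotDl !dot_ones_odd.
  by do 2!case: odd; rewrite // ?addxx_F2 ?eqxx.
(* If y is odd, x and y have weight at least 1 each, which gives the + 2. If y is even, x + y is odd
   and no heavier than x and y together. *)
have := wtD x y; have [odd_y|ev_y] := boolP (odd (wt y)).
  have := minB z dB_z; rewrite -yz => /(_ odd_y).
  by case: (wt x) odd_x (wt y) odd_y => // [p] _ [|q] //; lia.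
have := minA _ dA_xy; rewrite odd_xy odd_x (negPf ev_y) => /(_ isT); lia.
Qed.

Lemma attains_dual_wt_double d :
  attains_dual_wt A d -> attains_dual_wt (double A B) d.
Proof.
case=> z [dA_z odd_z wt_z]; exists (row_mx z (row_mx 0 0)).
rewrite !wt_row_mx !wt0 !addn0; split => //.
apply/mem_dual_double; rewrite addr0 !wt0; split => //.
by apply/mem_dualP => c _; rewrite -[LHS]/(dot _ _) dot0l.
Qed.

Hypotheses (odd_n1 : odd n1) (odd_n2 : odd n2).

(** The product a.a' occurs in two blocks and cancels; b.b' vanishes by hypothesis and the terms
    linear in c or c' vanish by evenness. The term c c' occurs with coefficient n1 + n2, which is
    even. *)
Lemma self_orthogonal_double :
  even_code A -> self_orthogonal B -> self_orthogonal (double A B).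
Proof.
move=> evA orthB u v /mem_doubleP[a [b [c [Aa Bb ->]]]].
case/mem_doubleP=> [a' [b' [c' [Aa' Bb' ->]]]].
have evB := self_orthogonal_even orthB.
rewrite !dot_row_mx !(dotDl, dotDr, dotZl, dotZr) !dot_ones_ones_odd //.
rewrite ![dot (ones _) _]dotC !evA // !evB // orthB //.
by rewrite !(mulr0, addr0, add0r) -addrA addxx_F2 addr0 addxx_F2.
Qed.

(** The same cancellation one level up: the triple product on A occurs twice, terms with one scalar
    are pairings, terms with two scalars are parities, and c c' c'' has the even coefficient n1 +
    n2. *)
Lemma triorthogonal_double :
  self_orthogonal A -> triorthogonal_space B ->
  triorthogonal_space (double A B).
Proof.
move=> orthA triB u v w /mem_doubleP[a [b [c [Aa Bb ->]]]].
case/mem_doubleP=> [a' [b' [c' [Aa' Bb' ->]]]].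
case/mem_doubleP=> [a'' [b'' [c'' [Aa'' Bb'' ->]]]].
have evA := self_orthogonal_even orthA.
have orthB := triorthogonal_self_orthogonal triB.
have evB := self_orthogonal_even orthB.
rewrite !triple_row_mx !tripleD_ones !dot_ones_ones_odd //.
rewrite triB // !evA // !evB // !orthA // !orthB //.
by rewrite !(mulr0, addr0, add0r, mulr1) -addrA addxx_F2 addr0 addxx_F2.
Qed.

End DoublingProperties.

(** * The rotated surface code *)

Lemma dot_delta n (i : 'I_n) (u : 'rV['F_2]_n) : dot (delta_mx 0 i) u = u 0 i.
Proof.
rewrite /dot (bigD1 i) //= mxE !eqxx mul1r big1 ?addr0 // => j ji.
by rewrite mxE (negPf ji) mul0r.
Qed.

Section Surface.
Variable d : nat.
Implicit Types (u v : 'rV['F_2]_d) (W : 'M['F_2]_d) (w z : 'rV['F_2]_(d * d)).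

(** Plaquettes are rank-one matrices, so checking a vector against one evaluates a bilinear form in
    its d x d matrix. *)
Lemma dot_mxvec u v W :
  dot (mxvec W) (mxvec (u^T *m v)) = (u *m W *m v^T) 0 0.
Proof. by rewrite -mxvec_dotmul dot_mx mxE mulr1n dotC. Qed.

Lemma dot_mxvec_rank1 u v u' v' :
  dot (mxvec (u^T *m v)) (mxvec (u'^T *m v')) = dot u' u * dot v v'.
Proof.
by rewrite dot_mxvec mulmxA -mulmxA !dot_mx mul_scalar_mx !mxE mulr1n.
Qed.

Lemma ones_mxvec : ones (d * d) = mxvec ((ones d)^T *m ones d).
Proof.
apply/rowP => j; case/mxvec_indexP: j => x y.
by rewrite mxvecE !mxE big_ord1 !mxE mulr1.
Qed.

Lemma segmentE i (lti : (i.+1 < d)%N) :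
  segment d i%:Z = delta_mx 0 (Ordinal (ltnW lti)) + delta_mx 0 (Ordinal lti).
Proof.
apply/rowP => x; rewrite !mxE !inE eqxx -!val_eqE /=.
have [->|xi] := eqVneq (x : nat) i; first by rewrite eqxx ltn_eqF ?addr0.
by rewrite -PoszD addn1 !eqz_nat (negPf xi) add0r.
Qed.

Lemma dot_segment_ones i : (i.+1 < d)%N -> dot (segment d i%:Z) (ones d) = 0.
Proof. by move=> lti; rewrite segmentE dotDl !dot_delta !mxE addxx_F2. Qed.

(** Here b is shifted by one to make it a natural number, which flips the parity condition; the same
    is done to a for the Z-generators. *)
Lemma surface_X_generatorsP g :
  reflect (exists a b : nat, [/\ (a.+1 < d)%N, (b <= d)%N, ~~ odd (a + b)
             & g = plaquette d a%:Z (b%:Z - 1)])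
          (g \in surface_X_generators d).
Proof.
apply: (iffP mapP) => [[p + ->]|[a [b [lta leb ev ->]]]].
  rewrite mem_filter => /andP[oddX /allpairsP[[a b]]] /=.
  rewrite -[0%N :: _]/(iota 0 d.+1) !mem_iota => -[lta ltb pE]; rewrite {}pE /= in oddX *.
  by exists a, b; split=> //; lia.
exists (a%:Z, b%:Z - 1) => //; rewrite mem_filter; apply/andP; split; first by rewrite /=; lia.
by apply/allpairsP; exists (a, b); rewrite !mem_iota; split=> //=; lia.
Qed.

Lemma surface_Z_generatorsP g :
  reflect (exists a b : nat, [/\ (a <= d)%N, (b.+1 < d)%N, odd (a + b)
             & g = plaquette d (a%:Z - 1) b%:Z])
          (g \in surface_Z_generators d).
Proof.
apply: (iffP mapP) => [[p + ->]|[a [b [lea ltb ev ->]]]].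
  rewrite mem_filter => /andP[oddX /allpairsP[[a b]]] /=.
  rewrite -[0%N :: _]/(iota 0 d.+1) !mem_iota => -[lta ltb pE]; rewrite {}pE /= in oddX *.
  by exists a, b; split=> //; lia.
exists (a%:Z - 1, b%:Z) => //; rewrite mem_filter; apply/andP; split; first by rewrite /=; lia.
by apply/allpairsP; exists (a, b); rewrite !mem_iota; split=> //=; lia.
Qed.

Lemma surface_C2_even : even_code (surface_C2 d).
Proof.
suff /dual_orth Ed : ones (d * d) \in dual (surface_C2 d).
  by move=> u /Ed; rewrite dotC.
apply/mem_dual_span => _ /surface_X_generatorsP[a [b [lta _ _ ->]]].
by rewrite plaquetteE ones_mxvec dot_mxvec_rank1 dot_segment_ones ?mul0r.
Qed.

Lemma ones_surface_C1 : ones (d * d) \in surface_C1 d.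
Proof.
apply/mem_dual_span => _ /surface_Z_generatorsP[a [b [_ ltb _ ->]]].
by rewrite plaquetteE ones_mxvec dot_mxvec_rank1 dotC mulrC dotC
  [dot (ones d) _]dotC dot_segment_ones ?mul0r.
Qed.

(* [segment d (b - 1)] meets the grid in {b - 1, b}, so only [b = y] and
   [b = y + 1] contribute at [y]. *)
Lemma sum_segment (c : nat -> 'F_2) :
  \sum_(b < d.+1) c b *: segment d (b%:Z - 1) = \row_(y < d) (c y + c y.+1).
Proof.
apply/rowP => y; rewrite summxE mxE.
have lty : (y < d.+1)%N := ltnW (ltn_ord y).
have ltSy : (y.+1 < d.+1)%N by rewrite ltnS.
rewrite (bigD1 (Ordinal lty)) //= (bigD1 (Ordinal ltSy)) /=; last first.
  by rewrite -val_eqE /=; lia.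
rewrite big1 ?addr0 => [|b /andP[/eqP/val_eqP/= b1 /eqP/val_eqP/= b2]].
  rewrite !mxE !inE.
  have -> : (y%:Z == y%:Z - 1) || (y%:Z == y%:Z - 1 + 1) by lia.
  have -> : (y%:Z == y.+1%:Z - 1) || (y%:Z == y.+1%:Z - 1 + 1) by lia.
  by rewrite !mulr1.
rewrite !mxE !inE.
have -> : (y%:Z == b%:Z - 1) || (y%:Z == b%:Z - 1 + 1) = false by lia.
by rewrite mulr0.
Qed.

(** These are the combinations, with coefficients c, of the X-plaquettes on the columns a and a + 1;
    c may be nonzero only where such a generator exists. *)
Lemma surface_C2_segment (a : nat) (c : nat -> 'F_2) : (a.+1 < d)%N ->
    (forall b, c b != 0 -> ~~ odd (a + b)) ->
  mxvec ((segment d a%:Z)^T *m \row_(y < d) (c y + c y.+1)) \in surface_C2 d.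
Proof.
move=> lta c_ev; rewrite -sum_segment mulmx_sumr linear_sum /=.
apply: memv_suml => b _; rewrite -scalemxAr linearZ /= -plaquetteE.
have [->|/c_ev ev] := eqVneq (c b) 0; first by rewrite scale0r mem0v.
apply/memvZ/memv_span/surface_X_generatorsP.
by exists a, b; split=> //; rewrite -ltnS.
Qed.

(** The X-plaquettes on the columns a and a + 1 tile them: exactly one of y and y + 1 has the
    admissible parity. *)
Lemma surface_C2_two_rows (a : nat) : (a.+1 < d)%N ->
  mxvec ((segment d a%:Z)^T *m ones d) \in surface_C2 d.
Proof.
move=> lta; pose c b : 'F_2 := (~~ odd (a + b))%:R.
have -> : ones d = \row_(y < d) (c y + c y.+1).
  by apply/rowP => y; rewrite !mxE /c addnS /= negbK; case: odd; rewrite ?addr0 ?add0r.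
by apply: surface_C2_segment => // b; rewrite /c; case: odd.
Qed.

(** * Column elimination in the surface code *)

Lemma mul_row_entry u W i x y : (u^T *m row i W) x y = u 0 x * W i y.
Proof. by rewrite mxE big_ord1 !mxE. Qed.

Lemma surface_C1_check w (a b : nat) : w \in surface_C1 d ->
    (a <= d)%N -> (b.+1 < d)%N -> odd (a + b) ->
  (segment d (a%:Z - 1) *m vec_mx w *m (segment d b%:Z)^T) 0 0 = 0.
Proof.
move=> C1w lea ltb oddab; rewrite -dot_mxvec vec_mxK -plaquetteE.
by apply: (mem_dual_span _ _ C1w); apply/surface_Z_generatorsP; exists a, b.
Qed.

Lemma mul_segment (b : nat) (ltb : (b.+1 < d)%N) (u : 'rV['F_2]_d) :
  (u *m (segment d b%:Z)^T) 0 0 = u 0 (Ordinal (ltnW ltb)) + u 0 (Ordinal ltb).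
Proof. by rewrite dot_mx mxE mulr1n dotC segmentE dotDl !dot_delta. Qed.

(* Row i of W is the grid column x = i. The checks based at x = i - 1 (and, for
   the last column, those at x = d - 1) see only column i once the earlier
   columns vanish. *)
Lemma segment_row W (i : 'I_d) (a : nat) :
    (i = a :> nat) \/ (i.+1 = a /\ a = d) ->
    (forall x y : 'I_d, (x < i)%N -> W x y = 0) ->
  segment d (a%:Z - 1) *m W = row i W.
Proof.
move=> ia W0; apply/rowP => y; rewrite !mxE (bigD1 i) //= big1 ?addr0.
  rewrite mxE !inE.
  have -> : (i%:Z == a%:Z - 1) || (i%:Z == a%:Z - 1 + 1) by lia.
  by rewrite mul1r.
move=> x xi; have [/W0->|] := ltnP x i; first by rewrite mulr0.
rewrite leq_eqVlt val_eqE eq_sym (negPf xi) /= => ix.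
rewrite mxE !inE.
have -> : (x%:Z == a%:Z - 1) || (x%:Z == a%:Z - 1 + 1) = false.
  by have := ltn_ord x; lia.
by rewrite mul0r.
Qed.

Lemma surface_C1_row w (i : 'I_d) (a b : nat) (ltb : (b.+1 < d)%N) :
    w \in surface_C1 d -> (i = a :> nat) \/ (i.+1 = a /\ a = d) ->
    (forall x y : 'I_d, (x < i)%N -> vec_mx w x y = 0) -> odd (a + b) ->
  vec_mx w i (Ordinal (ltnW ltb)) = vec_mx w i (Ordinal ltb).
Proof.
move=> C1w ia w0 oddab.
have lea : (a <= d)%N by have := ltn_ord i; lia.
have := surface_C1_check C1w lea ltb oddab.
by rewrite (segment_row ia w0) mul_segment ![row i _ _ _]mxE => /addr_eq0_F2.
Qed.

(** Gaussian elimination by columns. Once the columns before j vanish, the Z-checks make column j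
    constant on the pairs {b, b + 1} with j + b odd. It is then a trace of X-plaquettes on the
    columns j and j + 1, and subtracting these clears it without touching earlier columns. *)
Lemma surface_C1_eliminate w j : w \in surface_C1 d -> (j < d)%N ->
  exists2 s, s \in surface_C2 d &
    forall x y : 'I_d, (x < j)%N -> vec_mx (w - s) x y = 0.
Proof.
move=> C1w; elim: j => [|j IHj] ltj; first by exists 0; rewrite ?mem0v.
have [s C2s ws0] := IHj (ltnW ltj).
have C1ws : w - s \in surface_C1 d.
  by rewrite memvB // (subvP (surface_sub d)).
pose i := Ordinal (ltnW ltj); set W := vec_mx (w - s) in ws0.
have ltd : (d.-1 < d)%N by rewrite ltn_predL (leq_trans _ ltj).
(* The default repeats the last entry at b = d, the index of the boundary plaquette that meets
   column j only in y = d - 1. *)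
pose t b := W i (insubd (Ordinal ltd) b).
pose c b : 'F_2 := (~~ odd (j + b))%:R * t b.
have rowE : row i W = \row_(y < d) (c y + c y.+1).
  apply/rowP => y; rewrite [LHS]mxE [RHS]mxE /c addnS /= negbK.
  have ty : t y = W i y by rewrite /t valKd.
  have [odd_jy|_] := boolP (odd (j + y)); last by rewrite mul1r mul0r addr0.
  rewrite mul0r add0r mul1r -ty /t; have [ltSy|] := ltnP y.+1 d.
    have -> : insubd (Ordinal ltd) y = Ordinal (ltnW ltSy).
      by apply: val_inj; rewrite val_insubd ltn_ord.
    have -> : insubd (Ordinal ltd) y.+1 = Ordinal ltSy.
      by apply: val_inj; rewrite val_insubd ltSy.
    by apply: (surface_C1_row _ C1ws _ _ odd_jy) => //; left.
  move=> led; congr (W i _); apply: val_inj.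
  by rewrite !val_insubd ltn_ord ltnNge led /=; have := ltn_ord y; lia.
have C2c : mxvec ((segment d j%:Z)^T *m row i W) \in surface_C2 d.
  rewrite rowE; apply: surface_C2_segment => // b; rewrite /c.
  by case: odd; rewrite ?mul0r ?eqxx.
exists (s + mxvec ((segment d j%:Z)^T *m row i W)) => [|x y]; first exact: memvD.
rewrite ltnS leq_eqVlt opprD addrA linearB /= mxvecK -/W.
rewrite [LHS]mxE [X in _ + X]mxE mul_row_entry [segment _ _ _ _]mxE !inE.
case/orP=> [/eqP xj|ltxj].
  have -> : x = i by apply: val_inj.
  by rewrite eqxx mul1r subrr.
have -> : (x%:Z == j%:Z) || (x%:Z == j%:Z + 1) = false by lia.
by rewrite ws0 // mul0r subrr.
Qed.

Hypothesis odd_d : odd d.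

Let d_gt0 : (0 < d)%N. Proof. exact: odd_gt0. Qed.
Let last_x : 'I_d := Ordinal (etrans (ltn_predL d) d_gt0).

(** Elimination leaves only the last column. Checks of both parities act on it alone, so all its
    neighbouring entries agree and it is constant. *)
Lemma surface_C1_last w : w \in surface_C1 d ->
  exists c, w - c *: mxvec ((delta_mx 0 last_x)^T *m ones d) \in surface_C2 d.
Proof.
move=> C1w; have ltd : (d.-1 < d)%N by rewrite ltn_predL.
have [s C2s ws0] := surface_C1_eliminate C1w ltd.
have C1ws : w - s \in surface_C1 d.
  by rewrite memvB // (subvP (surface_sub d)).
set W := vec_mx (w - s) in ws0.
have W_step b (ltb : (b.+1 < d)%N) :
    W last_x (Ordinal (ltnW ltb)) = W last_x (Ordinal ltb).
  (* As d is odd, odd b is handled by the check on the columns d - 2 and d - 1, even b by the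
     boundary check on column d - 1. *)
  have [odd_b|ev_b] := boolP (odd b).
    apply: (@surface_C1_row _ _ d.-1) => //; first by left.
    by move: odd_d odd_b d_gt0; lia.
  apply: (@surface_C1_row _ _ d) => //; first by right; rewrite /= prednK.
  by rewrite oddD odd_d.
have W_last b (ltb : (b < d)%N) : W last_x (Ordinal ltb) = W last_x (Ordinal d_gt0).
  elim: b ltb => [|b IHb] ltb; first by congr (W _ _); apply: val_inj.
  by rewrite -W_step IHb.
exists (W last_x (Ordinal d_gt0)); suff -> : w - W last_x (Ordinal d_gt0) *:
  mxvec ((delta_mx 0 last_x)^T *m ones d) = s by [].
apply/eqP; rewrite subr_eq addrC -subr_eq; apply/eqP.
rewrite -[LHS]vec_mxK -/W -linearZ /=; congr mxvec; apply/matrixP => x y.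
have -> : ones d = row x (const_mx 1) by rewrite row_const.
rewrite [RHS]mxE mul_row_entry [delta_mx _ _ _ _]mxE [const_mx _ _ _]mxE eqxx /= mulr1.
have [->|x_last] := eqVneq x last_x.
  by rewrite mulr1 -(W_last y (ltn_ord y)); congr (W _ _); apply: val_inj.
rewrite mulr0 ws0 //; have := ltn_ord x.
by have : x != d.-1 :> nat; [| lia]; move: x_last; rewrite -val_eqE.
Qed.

(** Modulo C2 every vector of C1 is a multiple of the last column l. The all-ones vector has odd
    weight while C2 is even, so it is congruent to l and can replace it. *)
Lemma surface_C1E : surface_C1 d = add_ones (surface_C2 d).
Proof.
apply/eqP; rewrite eqEsubv subv_add surface_sub -memvE ones_surface_C1 !andbT.
have odd_dd : odd (d * d) by rewrite oddM odd_d.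
have [c1] := surface_C1_last ones_surface_C1.
set l := mxvec _; case: (F2P c1) => ->.
  rewrite scale0r subr0 => /surface_C2_even/eqP.
  by rewrite dot_ones_odd wt_ones odd_dd.
rewrite scale1r => C2l; apply/subvP => w /surface_C1_last[c C2w].
apply/mem_add_onesP; exists (w - c *: l - c *: (ones _ - l)).
  by rewrite memvB ?memvZ.
by exists c; rewrite scalerBr opprB addrA subrK subrK.
Qed.

(** * Odd dual weights of the surface code *)

Lemma sum_mxvec_index (R : nmodType) (F : 'I_(d * d) -> R) :
  \sum_j F j = \sum_(x < d) \sum_(y < d) F (mxvec_index x y).
Proof.
rewrite pair_bigA /=; have [g gK Kg] := curry_mxvec_bij d d.
rewrite (reindex (uncurry (@mxvec_index d d))) /=; last by exists g.
by apply: eq_bigr => -[x y].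
Qed.

Lemma wt_mxvec W : wt (mxvec W) = (\sum_(x < d) \sum_(y < d) (W x y != 0)%R)%N.
Proof.
rewrite wtE sum_mxvec_index; apply: eq_bigr => x _; apply: eq_bigr => y _.
by rewrite mxvecE.
Qed.

(* The X-stabilizers on two adjacent columns multiply to both full columns, so
   all columns of a vector of the dual have the same parity. *)
Lemma surface_min_dual_wt : min_dual_wt (surface_C2 d) d.
Proof.
move=> z dz odd_z; rewrite -[z]vec_mxK; set W := vec_mx z.
pose p (x : 'I_d) := dot (row x W) (ones d).
have p_step b (ltb : (b.+1 < d)%N) : p (Ordinal (ltnW ltb)) = p (Ordinal ltb).
  have := dual_orth dz (surface_C2_two_rows ltb).
  rewrite -[z]vec_mxK dot_mxvec segmentE mulmxDl -!rowE mulmxDl !dot_mx !mxE.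
  by rewrite !mulr1n -/W -/(p _) -/(p _) => /addr_eq0_F2.
have p_const x : p x = p (Ordinal d_gt0).
  case: x => b ltb; elim: b ltb => [|b IHb] ltb.
    by congr p; apply: val_inj.
  by rewrite -p_step IHb.
have pE : dot z (ones (d * d)) = \sum_x p x.
  rewrite dot_ones sum_mxvec_index; apply: eq_bigr => x _.
  by rewrite /p dot_ones; apply: eq_bigr => y _; rewrite !mxE.
(* The d equal column parities sum to 1, so each is 1 and no column is empty. *)
have p1 : p (Ordinal d_gt0) = 1.
  move: odd_z; rewrite odd_wt pE (eq_bigr _ (fun x _ => p_const x)).
  rewrite sumr_const card_ord -mulr_natr natr_F2 odd_d mulr1.
  by case: (F2P (p (Ordinal d_gt0))) => ->.
rewrite wt_mxvec -[X in (X <= _)%N]card_ord -sum1_card leq_sum // => x _.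
rewrite lt0n; apply: contra_eq_neq (p_const x) => /eqP.
rewrite sum_nat_eq0 => /forallP Wx0; rewrite p1 /p dot_ones big1 // => y _.
by move: (Wx0 y); rewrite [row _ _ _ _]mxE eqb0 negbK => /eqP.
Qed.

Lemma surface_attains_dual_wt : attains_dual_wt (surface_C2 d) d.
Proof.
pose y0 := Ordinal d_gt0.
(* The line y = 0, which every X-plaquette meets in zero or two points. *)
pose z := mxvec ((ones d)^T *m delta_mx 0 y0).
have wt_z : wt z = d.
  rewrite wt_mxvec -[RHS]card_ord -sum1_card; apply: eq_bigr => x _.
  rewrite (bigD1 y0) //= !mxE big_ord1 !mxE !eqxx /= big1 ?addn0 // => y y_0.
  by rewrite !mxE big_ord1 !mxE (negPf y_0) mulr0.
exists z; rewrite wt_z; split=> //.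
apply/mem_dual_span => _ /surface_X_generatorsP[a [b [lta _ _ ->]]].
by rewrite plaquetteE dot_mxvec_rank1 dot_segment_ones ?mul0r.
Qed.

End Surface.

(** * Triorthogonal codes from the doubled spaces *)

Section CssAddOnes.
Variables (n : nat) (C : code n).

(** Here d_z equals d, whereas d_x is only known to exist and to be at least d, which suffices for
    the minimum of the two. *)
Lemma css_parameters_add_ones d :
    odd n -> self_orthogonal C -> min_dual_wt C d -> attains_dual_wt C d ->
  css_parameters (CSSCode (sub_add_ones C)) 1 d.
Proof.
move=> odd_n orthC minC [z [dCz odd_z wt_z]].
have evC := self_orthogonal_even orthC.
have C_odd : ones n \notin C.
  by apply/negP => /evC/eqP; rewrite dot_ones_odd wt_ones odd_n.
have ones_n0 : ones n != 0 by apply: contraNneq C_odd => ->; exact: mem0v.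
split=> /=.
  rewrite dimv_disjoint_sum; first by rewrite dim_vline ones_n0 addKn.
  apply/eqP; rewrite -subv0; apply/subvP => v.
  rewrite memv_cap memv0 => /andP[Cv /vlineP[x xE]].
  case: (F2P x) xE Cv => -> ->; first by rewrite scale0r.
  by rewrite scale1r (negPf C_odd).
have logX_ones : logicalX (CSSCode (sub_add_ones C)) (ones n).
  rewrite /logicalX /= C_odd andbT; apply/mem_add_onesP.
  by exists 0; rewrite ?mem0v //; exists 1; rewrite scale1r add0r.
have [v logX_v min_v] :=
  @arg_minnP _ (ones n) (logicalX (CSSCode (sub_add_ones C))) (@wt n) logX_ones.
(* A logical X is also a logical Z because C is self-orthogonal. *)
have le_d u : logicalX (CSSCode (sub_add_ones C)) u -> (d <= wt u)%N.
  case/andP=> /= /mem_add_onesP[c Cc [x ->]].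
  case: (F2P x) => ->; first by rewrite scale0r addr0 Cc.
  rewrite scale1r => _; apply: minC; last first.
    by rewrite odd_wt dotDl evC // add0r dot_ones_odd wt_ones odd_n.
  apply/mem_dualP => c' Cc'; rewrite -[LHS]/(dot _ _) dotDl orthC // add0r.
  by rewrite dotC evC.
exists (wt v), d; split; last by apply/esym/minn_idPr/le_d.
- by split=> //; exists v.
- split=> [|u].
    by exists z; rewrite // /logicalZ /= mem_dual_add_ones dCz odd_z.
  rewrite /logicalZ /= mem_dual_add_ones => /andP[dCu].
  by rewrite dCu negbK; apply: minC.
Qed.

(** Only C2 has to be punctured by hand: the all-ones vector restricts to the all-ones vector, and
    shortening follows by duality. *)
Lemma local_geometry_add_ones n' (f : 'I_n' -> 'I_n) (Q' : css_code n') :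
    injective f -> css_C1 Q' = add_ones (css_C2 Q') ->
    punctured f C = [set c in css_C2 Q'] ->
  has_local_geometry (CSSCode (sub_add_ones C)) Q'.
Proof.
move=> f_inj Q'1 fC.
have fC1 : punctured f (add_ones C) = [set c in css_C1 Q'].
  by rewrite Q'1; apply: punctured_add_ones.
by exists f; split=> //; apply: shortened_dual.
Qed.

Lemma rowspan_vbasis :
  rowspan (\matrix_(i < \dim C) tnth (vbasis C) i) = C.
Proof.
rewrite -[RHS](span_basis (vbasisP C)) -[in RHS](map_tnth_enum (vbasis C)).
by congr <<_>>%VS; apply: eq_map => i; rewrite rowK.
Qed.

Lemma mem_rowspan m (G : 'M['F_2]_(m, n)) i : row i G \in rowspan G.
Proof. by apply/memv_span/map_f; rewrite mem_enum. Qed.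

Lemma rowspan_col_mx m1 m2 (G1 : 'M['F_2]_(m1, n)) (G2 : 'M['F_2]_(m2, n)) :
  rowspan (col_mx G1 G2) = (rowspan G1 + rowspan G2)%VS.
Proof.
apply/eqP; rewrite eqEsubv subv_add; apply/and3P; split.
- apply/span_subvP => _ /mapP[i _ ->].
  case: (split_ordP i) => i' ->; rewrite ?rowKu ?rowKd.
    by rewrite (subvP (addvSl _ _)) ?mem_rowspan.
  by rewrite (subvP (addvSr _ _)) ?mem_rowspan.
- apply/span_subvP => _ /mapP[i _ ->].
  by rewrite -(rowKu i G1 G2) mem_rowspan.
- apply/span_subvP => _ /mapP[i _ ->].
  by rewrite -(rowKd i G1 G2) mem_rowspan.
Qed.

(** G1 is the all-ones row and G0 a basis of C. With increasing indices only the first row of a pair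
    or triple can be all-ones, and then the sum drops to a parity or a pairing in C. *)
Lemma triorthogonal_code_add_ones :
    odd n -> triorthogonal_space C ->
  triorthogonal_code 1 (CSSCode (sub_add_ones C)).
Proof.
move=> odd_n triC.
have orthC := triorthogonal_self_orthogonal triC.
have evC := self_orthogonal_even orthC.
have [m [G0 G0C]] : exists m (G0 : 'M['F_2]_(m, n)), rowspan G0 = C.
  by exists (\dim C), (\matrix_i tnth (vbasis C) i); apply: rowspan_vbasis.
have row_ones i : row i (ones n) = ones n by rewrite row_const.
exists m, (ones n), G0; set G := col_mx _ _.
have rowsE (a : 'I_(1 + m)) : row a G = ones n \/ row a G \in C.
  by case: (split_ordP a) => i ->; rewrite ?rowKu ?rowKd;
    [left | right; rewrite -G0C mem_rowspan].
have rowsC (a : 'I_(1 + m)) : (0 < a)%N -> row a G \in C.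
  case: (split_ordP a) => i -> /=; rewrite ?ord1 // => _.
  by rewrite rowKd -G0C mem_rowspan.
have dotE a b : \sum_j G a j * G b j = dot (row a G) (row b G).
  by apply: eq_bigr => j _; rewrite ![row _ _ _ _]mxE.
have tripleE a b c :
    \sum_j G a j * G b j * G c j = triple (row a G) (row b G) (row c G).
  by apply: eq_bigr => j _; rewrite ![row _ _ _ _]mxE.
split=> //=; last 3 first.
- by move=> i; rewrite row_ones wt_ones.
- by move=> i; rewrite -G0C in evC; rewrite odd_wt evC ?mem_rowspan ?eqxx.
- rewrite rowspan_col_mx G0C addvC; congr (_ + _)%VS.
  by rewrite /rowspan enum_ordSl enum_ord0 /= row_ones span_seq1.
- split=> [a b ltab|a b c ltab ltbc].
    have Cb := rowsC b (leq_ltn_trans (leq0n _) ltab).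
    rewrite dotE; case: (rowsE a) => [->|Ca]; last exact: orthC.
    by rewrite dotC evC.
  have Cb := rowsC b (leq_ltn_trans (leq0n _) ltab).
  have Cc := rowsC c (leq_ltn_trans (leq0n _) ltbc).
  rewrite tripleE; case: (rowsE a) => [->|Ca]; last exact: triC.
  rewrite -[RHS](orthC _ _ Cb Cc).
  by apply: eq_bigr => j _; rewrite mxE mul1r.
Qed.

End CssAddOnes.

(** * The two recursive families *)

Definition punctures_to n (C : code n) n' (C' : code n') : Prop :=
  exists2 f : 'I_n' -> 'I_n, injective f & punctured f C = [set c in C'].

Lemma punctures_to_double n1 n2 (A : code n1) (B : code n2) n' (C' : code n') :
  punctures_to A C' -> punctures_to (double A B) C'.
Proof.
case=> f f_inj fA; exists (@lshift n1 (n1 + n2) \o f).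
  exact/inj_comp/f_inj/lshift_inj.
exact/(punctured_comp _ fA)/punctured_double.
Qed.

Lemma punctures_to_refl n (C : code n) : punctures_to C C.
Proof.
exists id => //; apply/puncturedP; have id_col (c : 'rV['F_2]_n) : colsub id c = c.
  by apply/rowP => i; rewrite mxE.
by split=> c Cc; rewrite ?id_col //; exists c.
Qed.

Lemma min_dual_wt1 n (C : code n) : min_dual_wt C 1.
Proof. by move=> z _; case: wt. Qed.

Lemma triorthogonal_space0 n : triorthogonal_space (0%VS : code n).
Proof.
move=> u v w; rewrite memv0 => /eqP-> _ _.
by apply: big1 => j _; rewrite mxE !mul0r.
Qed.

(* [k] is one less than in the theorem: the distance is 2 k + 1. *)
Lemma self_orthogonal_family k :
  exists (n : nat) (C : code n),
    [/\ (3 * n + 2 * k.+1 + 3 = 8 * (k.+1 * k.+1 * k.+1))%N, odd n,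
        self_orthogonal C, min_dual_wt C (2 * k + 1)
      & (0 < k)%N -> attains_dual_wt C (2 * k + 1) /\
                     punctures_to C (surface_C2 (2 * k + 1))].
Proof.
elim: k => [|k [n [C [nE odd_n orthC minC _]]]].
  (* The zero code of length 1 starts the recursion with distance 1. *)
  exists 1%N, 0%VS; split=> //; last exact: min_dual_wt1.
  exact/triorthogonal_self_orthogonal/triorthogonal_space0.
pose d := (2 * k.+1 + 1)%N; have odd_d : odd d by rewrite /d; lia.
have odd_dd : odd (d * d) by rewrite oddM odd_d.
exists (d * d + (d * d + n))%N, (double (surface_C2 d) C); split.
(* The lengths telescope: 6 d^2 = 8 (k + 2)^3 - 8 (k + 1)^3 - 2 for d = 2 k + 3. *)
- by move: nE; rewrite /d; nia.
- by rewrite !oddD odd_n odd_dd.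
- exact: self_orthogonal_double (@surface_C2_even d) orthC.
- have := min_dual_wt_double (surface_min_dual_wt odd_d) minC.
  by rewrite -/d; have -> : minn d (2 * k + 1 + 2) = d by rewrite /d; lia.
- move=> _; split; first exact/attains_dual_wt_double/surface_attains_dual_wt.
  exact/punctures_to_double/punctures_to_refl.
Qed.

(** Attainment and geometry come from the first block, a member of the self-orthogonal family with
    the new distance; the previous code supplies only its length, its orthogonality and the lower
    bound that grows by 2. *)
Lemma triorthogonal_family k :
  exists (n : nat) (C : code n),
    [/\ (3 * n + 8 * k.+1 + 3 = 4 * (k.+1 * k.+1 * k.+1 * k.+1)
           + 8 * (k.+1 * k.+1 * k.+1) + 2 * (k.+1 * k.+1))%N, odd n,
        triorthogonal_space C, min_dual_wt C (2 * k + 1)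
      & (0 < k)%N -> attains_dual_wt C (2 * k + 1) /\
                     punctures_to C (surface_C2 (2 * k + 1))].
Proof.
elim: k => [|k [n [C [nE odd_n triC minC _]]]].
  exists 1%N, 0%VS; split=> //; last exact: min_dual_wt1.
  exact: triorthogonal_space0.
have [n1 [A [n1E odd_n1 orthA minA /(_ isT)[attA geoA]]]] :=
  self_orthogonal_family k.+1.
exists (n1 + (n1 + n))%N, (double A C); split.
- by move: nE n1E; nia.
- by rewrite !oddD odd_n odd_n1.
- exact: triorthogonal_double.
- have := min_dual_wt_double minA minC.
  by have -> : minn (2 * k.+1 + 1) (2 * k + 1 + 2) = (2 * k.+1 + 1)%N by lia.
- by split; [apply: attains_dual_wt_double | apply: punctures_to_double].
Qed.

Theorem mainTheorem5 (k : nat) (hk : (2 <= k)%N) :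
  exists (n : nat) (Q : css_code n),
    [/\ n%:R = (4 * k%:R ^+ 4 + 8 * k%:R ^+ 3 + 2 * k%:R ^+ 2 - 8 * k%:R - 3) / 3
          :> rat,
        triorthogonal_code 1 Q,
        css_parameters Q 1 (2 * k - 1)%N
      & has_local_geometry Q (rotated_surface_code (2 * k - 1)%N)].
Proof.
(* In the indexing of the families the bound on k becomes positivity, which opens their guarded
   clause. *)
case: k hk => [|k] // hk.
have [n [C [nE odd_n triC minC /(_ hk)[attC [f f_inj fC]]]]] :=
  triorthogonal_family k.
have -> : (2 * k.+1 - 1 = 2 * k + 1)%N by lia.
exists n, (CSSCode (sub_add_ones C)); split.
- have := congr1 (fun m => m%:R : rat) nE; rewrite !natrD !natrM => E.
  apply: (mulIf (_ : 3 != 0 :> rat)) => //; rewrite divfK //.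
  by move: E; move: (k.+1%:R : rat) (n%:R : rat) => x y E; lra.
- exact: triorthogonal_code_add_ones.
- apply: css_parameters_add_ones => //.
  exact: triorthogonal_self_orthogonal.
- apply: (local_geometry_add_ones f_inj) => //=.
  by apply: surface_C1E; lia.
Qed.
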